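(* Let $n\ge0$. If $n\equiv0,1,2\pmod 4$, then $P_n(z)$ has no purely imaginary roots (roots of the form $iy$ with $y\in\mathbb{R}$). If $n\equiv3\pmod4$, then $P_n(z)$ has exactly one pair of purely imaginary roots, namely $\pm iy_0$ for a unique $y_0>0$.
   Context: For $0\le k\le n$ let $\mathcal{B}(n,k)=\binom{n}{\lfloor (n-k)/2\rfloor}$ and let $P_n(z)=\sum_{k=0}^n\mathcal{B}(n,k)z^{n-k}$. *)

(* Defs.v *)
From HB Require Import structures.
From mathcomp Require Import all_boot all_order all_algebra.
From mathcomp Require Import reals.
From mathcomp Require Import complex.

Set Implicit Arguments.
Unset Strict Implicit.
Unset Printing Implicit Defensive.

Import Order.TTheory GRing.Theory Num.Theory.
Local Open Scope ring_scope.

(* Meaningful for k <= n only: the subtraction is truncated. *)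
Definition ballot (n k : nat) : nat := 'C(n, (n - k)./2).

Definition ballot_poly (F : nzRingType) (n : nat) : {poly F} :=
  \sum_(0 <= k < n.+1) (ballot n k)%:R *: 'X^(n - k).

(* y *i is the complex number iy; zero counts as purely imaginary. *)
Definition purely_imaginary (R : realType) (z : R[i]) : Prop :=
  exists y : R, z = (y *i)%C.

(* Main.v *)
(** Write [n = 2N] or [n = 2N + 1].  Pairing the terms [z^(2m)] and
    [z^(2m+1)], which carry the same coefficient, gives
    [P_(2N+1)(z) = (1 + z) S(z^2)] with [S(x) = sum_(m <= N) C(n, m) x^m],
    and [P_(2N)] differs from such a product by the single term
    [C(n, N) z^(2N)], which forbids imaginary roots.  For [n = 2N + 1],
    Pascal's rule rewrites the truncated binomial expansion as
    [S(x) = sum_(j <= N) C(N+j, N) (1+x)^(N-j) x^j], so [S(-t)] has the sign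
    [(-1)^N] for [t >= 1]; applied to the complementary part of the binomial
    expansion, it gives [S(x) = (1+x)^n - x^(N+1) Q(1+x)] where [Q] has
    positive coefficients.  Hence [S(-t) > 0] for [0 <= t < 1] when [N] is
    even.  When [N] is odd, [S(-t) / (1-t)^n = 1 - t^(N+1) Q(1-t) / (1-t)^n]
    decreases strictly on [(0, 1)], while [S(0) > 0 > S(-1)]. *)
Require Import Defs.
From mathcomp Require Import all_boot all_order all_algebra.
From mathcomp Require Import reals.
From mathcomp Require Import complex.
From mathcomp Require Import polyrcf.
From mathcomp Require Import ring lra zify.

Import Order.TTheory GRing.Theory Num.Theory.
Local Open Scope ring_scope.

(** * Two expansions of the truncated binomial sum *)

Definition trunc_binomial {R : pzSemiRingType} (n K : nat) (x : R) : R :=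
  \sum_(m < K) 'C(n, m)%:R * x ^+ m.

(** This is the [Q] of the overview; with [s = 1 + x] it is the cofactor of [x^(N+1)] in the upper
    half of [(1+x)^(2N+1)]. *)
Definition binomial_tail {R : pzSemiRingType} (N : nat) (s : R) : R :=
  \sum_(j < N.+1) 'C(N + j, N)%:R * s ^+ (N - j).

Lemma trunc_binomial_at0 (R : pzSemiRingType) (n K : nat) :
  trunc_binomial n K.+1 (0 : R) = 1.
Proof.
rewrite /trunc_binomial big_ord_recl /= big1 ?addr0 ?bin0 ?mulr1 // => m _.
by rewrite expr0n mulr0.
Qed.

(** Induction on [N]: Pascal's rule turns the left side into [a + b] times the previous sum, plus
    the top term in [a^(N+1)]. The homogeneous form serves both [(a, b) = (x, 1)] and [(1, x)]. *)
Lemma truncated_exprDn (R : comPzRingType) (N M : nat) (a b : R) :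
  \sum_(m < N.+1) 'C((N + M).+1, m)%:R * (a ^+ m * b ^+ (N - m)) =
  \sum_(j < N.+1) 'C(M + j, M)%:R * ((a + b) ^+ (N - j) * a ^+ j).
Proof.
elim: N => [|N IHN].
  by rewrite !big_ord_recr !big_ord0 /= addn0 bin0 binn.
rewrite [RHS]big_ord_recr /= subnn expr0 mul1r.
have -> : \sum_(j < N.+1) 'C(M + j, M)%:R * ((a + b) ^+ (N.+1 - j) * a ^+ j) =
          (a + b) * \sum_(j < N.+1) 'C(M + j, M)%:R * ((a + b) ^+ (N - j) * a ^+ j).
  rewrite big_distrr /=; apply: eq_bigr => j _.
  by rewrite subSn ?exprS; [ring | rewrite -ltnS].
rewrite -IHN mulrDl.
have -> : \sum_(m < N.+2) 'C((N.+1 + M).+1, m)%:R * (a ^+ m * b ^+ (N.+1 - m)) =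
    \sum_(m < N.+2) 'C((N + M).+1, m)%:R * (a ^+ m * b ^+ (N.+1 - m)) +
    a * \sum_(m < N.+1) 'C((N + M).+1, m)%:R * (a ^+ m * b ^+ (N - m)).
  rewrite [LHS]big_ord_recl [X in X + _ = _]/= [X in _ = X + _]big_ord_recl /=.
  rewrite !bin0 -addrA; congr (_ + _).
  rewrite big_distrr -big_split /=; apply: eq_bigr => m _.
  by rewrite /bump /= !add1n addSn binS natrD exprS subSS; ring.
rewrite [X in X + _ = _]big_ord_recr /= subnn expr0 mulr1.
have -> : 'C(M + N.+1, M) = 'C((N + M).+1, N.+1).
  by rewrite -[RHS]bin_sub; [congr ('C(_, _)); lia | lia].
rewrite big_distrr /=.
have -> : \sum_(m < N.+1) 'C((N + M).+1, m)%:R * (a ^+ m * b ^+ (N.+1 - m)) =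
          \sum_(m < N.+1) b * ('C((N + M).+1, m)%:R * (a ^+ m * b ^+ (N - m))).
  apply: eq_bigr => m _.
  by rewrite subSn ?exprS; [ring | rewrite -ltnS].
by rewrite big_distrr /=; ring.
Qed.

Lemma trunc_binomialE (R : comPzRingType) (N : nat) (x : R) :
  trunc_binomial N.*2.+1 N.+1 x =
  \sum_(j < N.+1) 'C(N + j, N)%:R * ((x + 1) ^+ (N - j) * x ^+ j).
Proof.
rewrite -truncated_exprDn addnn; apply: eq_bigr => m _.
by rewrite expr1n mulr1.
Qed.

Lemma trunc_binomial_compl (R : comPzRingType) (N : nat) (x : R) :
  trunc_binomial N.*2.+1 N.+1 x =
  (1 + x) ^+ N.*2.+1 - x ^+ N.+1 * binomial_tail N (1 + x).
Proof.
have -> : binomial_tail N (1 + x) =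
          \sum_(m < N.+1) 'C(N.*2.+1, m)%:R * x ^+ (N - m).
  rewrite /binomial_tail -addnn.
  have := @truncated_exprDn R N N 1 x.
  under eq_bigr do rewrite expr1n mul1r.
  by move=> ->; apply: eq_bigr => j _; rewrite expr1n mulr1.
rewrite exprDn (_ : N.*2.+2 = (N.+1 + N.+1)%N); last by lia.
(* Reversing the upper half brings its coefficients, by symmetry, back to [C(2N+1, m)] with
   [m <= N]. *)
rewrite big_split_ord /= [X in _ + X - _](reindex_inj rev_ord_inj) /=.
have -> : \sum_(j < N.+1) (1 ^+ (N.*2.+1 - (N.+1 + (N.+1 - j.+1))) *
     x ^+ (N.+1 + (N.+1 - j.+1)) *+ 'C(N.*2.+1, N.+1 + (N.+1 - j.+1))) =
   x ^+ N.+1 * \sum_(m < N.+1) 'C(N.*2.+1, m)%:R * x ^+ (N - m).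
  rewrite big_distrr /=; apply: eq_bigr => j _.
  have lejN : (j <= N)%N by rewrite -ltnS.
  rewrite subSS expr1n mul1r exprD -mulr_natl.
  rewrite -[in LHS]bin_sub; last by lia.
  by rewrite (_ : (_ - _)%N = j); [ring | lia].
rewrite addrK; apply: eq_bigr => m _.
by rewrite expr1n mul1r mulr_natl.
Qed.

(** * Signs and zeros on the negative axis *)

Section Sign.
Context {R : realFieldType}.
Implicit Types (t s : R) (N : nat).

Lemma binomial_tail_gt0 N s : 0 <= s -> 0 < binomial_tail N s.
Proof.
move=> s0; rewrite /binomial_tail big_ord_recr /= subnn mulr1.
rewrite ltr_wpDl ?ltr0n ?bin_gt0 ?leq_addr //.
by apply: sumr_ge0 => j _; rewrite mulr_ge0 ?exprn_ge0.
Qed.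

(** Each [(1-t)^(N-j) (-t)^j] has total degree [N] in nonpositive factors; the term [j = N] makes
    the sum strict. *)
Lemma trunc_binomial_ge1 N t : 1 <= t ->
  0 < (-1) ^+ N * trunc_binomial N.*2.+1 N.+1 (- t).
Proof.
move=> t1; rewrite trunc_binomialE big_distrr /=.
have -> : \sum_(j < N.+1) (-1) ^+ N *
    ('C(N + j, N)%:R * ((- t + 1) ^+ (N - j) * (- t) ^+ j)) =
    \sum_(j < N.+1) 'C(N + j, N)%:R * ((t - 1) ^+ (N - j) * t ^+ j).
  apply: eq_bigr => j _; have lejN : (j <= N)%N by rewrite -ltnS.
  have -> : - t + 1 = - (t - 1) by ring.
  by rewrite (exprNn (t - 1)) (exprNn t) mulrACA -exprD subnK // [LHS]mulrCA signrMK.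
rewrite big_ord_recr /= subnn mul1r.
rewrite ltr_wpDl ?mulr_gt0 ?ltr0n ?bin_gt0 ?leq_addr ?exprn_gt0 //; try lra.
by apply: sumr_ge0 => j _; rewrite !mulr_ge0 ?exprn_ge0 //; lra.
Qed.

Lemma trunc_binomial_even_gt0 N t : ~~ odd N -> 0 <= t ->
  0 < trunc_binomial N.*2.+1 N.+1 (- t).
Proof.
move=> evN t0; have [t1|t1] := leP 1 t.
  by have := trunc_binomial_ge1 N _ t1; rewrite -signr_odd (negPf evN) mul1r.
(* For [t < 1]: as [N+1] is odd, the subtracted tail becomes a nonnegative summand. *)
rewrite trunc_binomial_compl exprNn -signr_odd /= evN mulN1r mulNr opprK.
rewrite ltr_wpDr ?exprn_gt0 ?mulr_ge0 ?exprn_ge0 //; last lra.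
by apply/ltW/binomial_tail_gt0; lra.
Qed.

(** Division-free form of: [Q(s) / s^(2N+1)] is nonincreasing. It holds termwise because
    [N - j <= 2N+1]. *)
Lemma binomial_tail_ratio N (s1 s2 : R) : 0 <= s2 -> s2 <= s1 ->
  s2 ^+ N.*2.+1 * binomial_tail N s1 <= s1 ^+ N.*2.+1 * binomial_tail N s2.
Proof.
move=> s20 s21; rewrite !big_distrr /=; apply: ler_sum => j _.
rewrite [leLHS]mulrCA [leRHS]mulrCA ler_wpM2l //.
have lek : (N - j <= N.*2.+1)%N by lia.
rewrite -(subnK lek) !exprD -!mulrA [s2 ^+ (N - j) * _]mulrC.
rewrite ler_wpM2r ?mulr_ge0 ?exprn_ge0 ?lerXn2r ?nnegrE //; lra.
Qed.

Lemma trunc_binomial_odd_root_lt1 N t : odd N -> 0 <= t ->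
  trunc_binomial N.*2.+1 N.+1 (- t) = 0 -> t < 1.
Proof.
move=> oN t0 rt; rewrite ltNge; apply/negP => /(trunc_binomial_ge1 N).
by rewrite rt mulr0 ltxx.
Qed.

Lemma trunc_binomial_odd_root_inj N (t1 t2 : R) : odd N -> 0 <= t1 -> 0 <= t2 ->
  trunc_binomial N.*2.+1 N.+1 (- t1) = 0 ->
  trunc_binomial N.*2.+1 N.+1 (- t2) = 0 -> t1 = t2.
Proof.
move=> oN.
wlog lt12 : t1 t2 / t1 < t2 => [th t10 t20 r1 r2|t10 t20 r1 r2].
  by case: (ltgtP t1 t2) => // lt; [exact: th | apply/esym/th].
have t2lt1 : t2 < 1 by apply: (@trunc_binomial_odd_root_lt1 N).
have rootE t : trunc_binomial N.*2.+1 N.+1 (- t) = 0 ->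
    (1 - t) ^+ N.*2.+1 = t ^+ N.+1 * binomial_tail N (1 - t).
  move/eqP; rewrite trunc_binomial_compl subr_eq0 => /eqP ->.
  by rewrite exprNn -signr_odd /= oN mul1r.
have le21 : 1 - t2 <= 1 - t1 by lra.
have ge02 : 0 <= 1 - t2 by lra.
have := @binomial_tail_ratio N _ _ ge02 le21.
(* After multiplication by [t1^(N+1)], the two root equations reduce this inequality to
   [t2^(N+1) <= t1^(N+1)], against [t1 < t2]. *)
move=> /(ler_wpM2l (exprn_ge0 N.+1 t10)); rewrite mulrCA -(rootE _ r1) leNgt.
case/negP; rewrite mulrCA [ltRHS]mulrC ltr_pM2l ?exprn_gt0 //; last by lra.
by rewrite (rootE _ r2) ltr_pM2r ?binomial_tail_gt0 ?ltrXn2r //.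
Qed.

End Sign.

Lemma trunc_binomial_odd_root (R : rcfType) (N : nat) : odd N ->
  exists2 t : R, 0 < t & trunc_binomial N.*2.+1 N.+1 (- t) = 0.
Proof.
move=> oN.
(* [S(-t)] as a polynomial in [t], for the intermediate value theorem on [(0, 1)]. *)
pose p : {poly R} := \sum_(m < N.+1) 'C(N.*2.+1, m)%:R *: (- 'X) ^+ m.
have pE t : p.[t] = trunc_binomial N.*2.+1 N.+1 (- t).
  rewrite horner_sum; apply: eq_bigr => m _.
  by rewrite hornerZ horner_exp hornerN hornerX.
have p0 : p.[0] = 1. by rewrite pE oppr0 trunc_binomial_at0.
have p1 : p.[1] < 0.
  have := trunc_binomial_ge1 N _ (lexx (1 : R)).
  by rewrite -pE -signr_odd oN mulN1r oppr_gt0.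
have [||t /andP[t0 _] /rootP rt] := @poly_ivtoo _ p 0 1 => //.
  by rewrite p0 mul1r.
by exists t; rewrite -?pE.
Qed.

(** * Ballot polynomials at imaginary points *)

Lemma trunc_binomial_rmorph (R S : pzRingType) (f : {rmorphism R -> S})
    (n K : nat) (x : R) :
  trunc_binomial n K (f x) = f (trunc_binomial n K x).
Proof.
rewrite rmorph_sum; apply: eq_bigr => m _.
by rewrite rmorphM rmorph_nat rmorphXn.
Qed.

Lemma horner_ballot_poly (R : comNzRingType) (n : nat) (z : R) :
  (ballot_poly R n).[z] = \sum_(j < n.+1) 'C(n, j./2)%:R * z ^+ j.
Proof.
rewrite /ballot_poly big_mkord horner_sum (reindex_inj rev_ord_inj) /=.
apply: eq_bigr => j _; have lejn : (j <= n)%N by rewrite -ltnS.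
by rewrite hornerZ hornerXn subSS /ballot !subKn.
Qed.

Lemma sum_half_pairs (R : comNzRingType) (n K : nat) (z : R) :
  \sum_(j < K.*2) 'C(n, j./2)%:R * z ^+ j =
  (1 + z) * trunc_binomial n K (z ^+ 2).
Proof.
rewrite /trunc_binomial; elim: K => [|K IHK]; first by rewrite !big_ord0 mulr0.
rewrite doubleS 3!big_ord_recr /= IHK doubleK uphalf_double -!exprM -mul2n (exprS z (2 * K)).
by ring.
Qed.

Lemma horner_ballot_poly_odd (R : comNzRingType) (N : nat) (z : R) :
  (ballot_poly R N.*2.+1).[z] =
  (1 + z) * trunc_binomial N.*2.+1 N.+1 (z ^+ 2).
Proof. by rewrite horner_ballot_poly -doubleS sum_half_pairs. Qed.

Lemma horner_ballot_poly_even (R : comNzRingType) (N : nat) (z : R) :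
  (ballot_poly R N.*2).[z] =
  (1 + z) * trunc_binomial N.*2 N (z ^+ 2) + 'C(N.*2, N)%:R * (z ^+ 2) ^+ N.
Proof.
rewrite horner_ballot_poly big_ord_recr /= sum_half_pairs doubleK.
by rewrite -exprM mul2n.
Qed.

Lemma sqr_imaginary (R : rcfType) (y : R) :
  (y *i)%C ^+ 2 = real_complex R (- y ^+ 2) :> R[i].
Proof.
apply/eqP; rewrite expr2 eq_complex /=.
by apply/andP; split; apply/eqP; ring.
Qed.

(** The value is [(1 + iy) A + B] with [A], [B] real, so a root would give [A + B = 0] and
    [y A = 0]. *)
Lemma ballot_poly_even_imaginary_root (R : rcfType) (N : nat) (y : R) :
  ~~ root (ballot_poly R[i] N.*2) (y *i)%C.
Proof.
rewrite /root horner_ballot_poly_even sqr_imaginary trunc_binomial_rmorph.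
set A := trunc_binomial _ _ _.
rewrite -(rmorph_nat (real_complex R)) -rmorphXn -rmorphM.
rewrite eq_complex /=; apply/negP => /andP[/eqP re /eqP im].
have {}re : A + 'C(N.*2, N)%:R * (- y ^+ 2) ^+ N = 0 by rewrite -re; ring.
have {im} /eqP : y * A = 0 by rewrite -im; ring.
rewrite mulf_eq0 => /orP[]/eqP zero.
  (* If [y = 0], the real part is the constant term 1. *)
  have : A + 'C(N.*2, N)%:R * (- y ^+ 2) ^+ N = trunc_binomial N.*2 N.+1 (- y ^+ 2).
    by rewrite /trunc_binomial big_ord_recr.
  rewrite re zero expr0n oppr0 trunc_binomial_at0 => /esym/eqP.
  by rewrite oner_eq0.
(* If [A = 0], then [B = 0] forces [N > 0] and [y = 0], where [A = 1]. *)
move: re; rewrite zero add0r => /eqP; rewrite mulf_eq0 pnatr_eq0.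
rewrite -leqn0 leqNgt bin_gt0 -addnn leq_addr /= expf_eq0 oppr_eq0.
rewrite sqrf_eq0 => /andP[N0 /eqP y0]; move: zero N0; rewrite /A y0.
case: N {A} => // K; rewrite expr0n oppr0 trunc_binomial_at0 => /eqP.
by rewrite oner_eq0.
Qed.

(** The factor [1 + iy] has real part 1 and never vanishes. *)
Lemma ballot_poly_odd_imaginary_root (R : rcfType) (N : nat) (y : R) :
  root (ballot_poly R[i] N.*2.+1) (y *i)%C =
  (trunc_binomial N.*2.+1 N.+1 (- y ^+ 2) == 0).
Proof.
rewrite /root horner_ballot_poly_odd sqr_imaginary trunc_binomial_rmorph.
rewrite mulf_eq0 fmorph_eq0; case: eqP => //= /eqP.
by rewrite eq_complex /= addr0 oner_eq0.
Qed.

Theorem theorem4p6 (R : realType) (n : nat) :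
  ((n = 0 %[mod 4])%N \/ (n = 1 %[mod 4])%N \/ (n = 2 %[mod 4])%N ->
     ~ exists z : R[i], purely_imaginary z /\ root (ballot_poly R[i] n) z)
  /\
  ((n = 3 %[mod 4])%N ->
     exists! y0 : R, 0 < y0 /\
       forall z : R[i],
         (purely_imaginary z /\ root (ballot_poly R[i] n) z) <->
         (z = (y0 *i)%C \/ z = - (y0 *i)%C)).
Proof.
split=> [n012 [_ [[y ->] rt]]|n3].
  have [oN|eN] := boolP (odd n); last first.
    have En : n = n./2.*2 by lia.
    by move: rt; rewrite En (negPf (ballot_poly_even_imaginary_root _ _ _)).
  have [En ev] : n = n./2.*2.+1 /\ ~~ odd n./2 by lia.
  move: rt; rewrite En ballot_poly_odd_imaginary_root.
  by rewrite gt_eqF // trunc_binomial_even_gt0 ?sqr_ge0.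
have [N En oN] : exists2 N, n = N.*2.+1 & odd N by exists n./2; lia.
have [t t0 rt] := @trunc_binomial_odd_root R _ oN.
(* [(iy)^2 = -y^2], so [iy] is a root exactly when [y^2] is the zero [t]. *)
exists (Num.sqrt t); split=> [|y [y0 /(_ (y *i)%C) Hy]].
  split=> [|z]; first by rewrite sqrtr_gt0.
  rewrite {}En; split=> [[[y ->]]|].
    rewrite ballot_poly_odd_imaginary_root => /eqP ry.
    have : y ^+ 2 = Num.sqrt t ^+ 2.
      rewrite sqr_sqrtr ?(ltW t0) //.
      by apply: (trunc_binomial_odd_root_inj N) => //; rewrite ?sqr_ge0 ?ltW.
    move/eqP; rewrite eqf_sqr => /orP[] /eqP ->; [left|right] => //.
    by apply/eqP; rewrite eq_complex /= oppr0 !eqxx.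
  case=> ->; split.
  - by exists (Num.sqrt t).
  - by rewrite ballot_poly_odd_imaginary_root sqr_sqrtr ?rt ?ltW.
  - by exists (- Num.sqrt t); apply/eqP; rewrite eq_complex /= oppr0 !eqxx.
  - have -> : - ((Num.sqrt t) *i)%C = ((- Num.sqrt t) *i)%C :> R[i].
      by apply/eqP; rewrite eq_complex /= oppr0 !eqxx.
    by rewrite ballot_poly_odd_imaginary_root sqrrN sqr_sqrtr ?rt ?ltW.
have [_] : purely_imaginary (y *i)%C /\ root (ballot_poly R[i] n) (y *i)%C.
  by apply/Hy; left.
rewrite En ballot_poly_odd_imaginary_root => /eqP ry.
have <- : y ^+ 2 = t.
  by apply: (trunc_binomial_odd_root_inj N) => //; rewrite ?sqr_ge0 ?ltW.
by rewrite sqrtr_sqr gtr0_norm.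
Qed.
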